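(* Let $m$ be an even positive integer not divisible by $3$ and let $a,d_1,d_2,d_3\in\mathbb{Z}/m\mathbb{Z}$ be such that $\gcd(d_1,m)=\gcd(d_3-d_2,m)=2$ and $d_2$, $d_3$, $d_2-d_1$, $d_1-d_3$ are invertible. Then the arithmetic tetrahedron $\mathrm{AS}(a,(d_1,d_2,d_3),s)$ is balanced for all positive integers $s\equiv 0$ or $-2\pmod m$.
   Context: $\mathrm{AS}(a,(d_1,d_2,d_3),s)=\{a+i_1d_1+i_2d_2+i_3d_3: i\in\mathbb{N}^3,\ i_1+i_2+i_3\le s-1\}$ as a multiset of $\mathbb{Z}/m\mathbb{Z}$. A multiset is balanced if every element of $\mathbb{Z}/m\mathbb{Z}$ occurs in it with the same multiplicity. For $x\in\mathbb{Z}/m\mathbb{Z}$, $\gcd(x,m)$ is the gcd of $m$ and any representative of $x$. *)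

(* Defs.v *)
From mathcomp Require Import all_boot all_order all_algebra.
From mathcomp Require Import finmap multiset.

Set Implicit Arguments.
Unset Strict Implicit.
Unset Printing Implicit Defensive.

Import GRing.Theory.
Local Open Scope ring_scope.

(* 'Z_m is Z/mZ only for 1 < m. *)

(* The constraint i1 + i2 + i3 <= s - 1 (s - 1 taken in Z, so that nothing
   satisfies it when s = 0) forces each i_j < s: the index set, a subset of
   N^3, is enumerated inside 'I_s * 'I_s * 'I_s. *)
Definition AS (m : nat) (a : 'Z_m) (d : 'Z_m * 'Z_m * 'Z_m) (s : nat) :
    {mset 'Z_m}%mset :=
  let: (d1, d2, d3) := d in
  seq_mset [seq a + d1 *+ i.1.1 + d2 *+ i.1.2 + d3 *+ i.2
             | i : 'I_s * 'I_s * 'I_s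
               in [pred i : 'I_s * 'I_s * 'I_s |
                    (i.1.1 + i.1.2 + i.2 < s)%N]].

Definition balanced (m : nat) (M : {mset 'Z_m}%mset) : Prop :=
  forall x y : 'Z_m, M x = M y.

(* Computed on the representative of x in [0, m). *)
Definition gcdZ (m : nat) (x : 'Z_m) : nat := gcdn x m.

(* Main.v *)
Require Import Defs.
From mathcomp Require Import all_boot all_order all_algebra all_field.
From mathcomp Require Import finmap multiset.
From mathcomp Require Import ring zify.

Set Implicit Arguments.
Unset Strict Implicit.
Unset Printing Implicit Defensive.

Import GRing.Theory Num.Theory.
Local Open Scope ring_scope.

(** By Fourier inversion on Z/mZ it suffices that the sum of [w ^+ u] over the
    tetrahedron vanishes for every m-th root of unity [w != 1]. Up to the factor
    [w ^+ a], this sum is the complete homogeneous symmetric polynomial of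
    degree [s - 1] evaluated at [w ^+ d1], [w ^+ d2], [w ^+ d3] and [1].
    If [w != -1] these are four distinct m-th roots of unity. The divided
    difference of [X ^+ n] at [r] distinct m-th roots of unity is the complete
    homogeneous symmetric polynomial of degree [n - r + 1] and depends only on
    [n] modulo [m], so it vanishes when [n] is congruent to one of
    [0, ..., r - 2]; here [r = 4] and [n = s + 2] is [2] or [0] modulo [m].
    If [w = -1] the four values form two pairs [x, - x]; each pair contributes
    the even factor [1 / (1 - x ^+ 2 * T ^+ 2)] to the generating series, so the
    polynomial vanishes in the odd degree [s - 1]. *)

Section CompleteSymmetricPolynomial.

Variable R : comNzRingType.
Implicit Types (x y z : R) (xs : seq R).

Fixpoint complete_sym xs n : R :=
  if xs is x :: xs' then \sum_(i < n.+1) x ^+ i * complete_sym xs' (n - i)%N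
  else (n == 0%N)%:R.

Lemma complete_sym0 xs : complete_sym xs 0 = 1.
Proof. by elim: xs => //= x xs IHxs; rewrite big_ord1 IHxs mulr1. Qed.

Lemma complete_sym_consS x xs n :
  complete_sym (x :: xs) n.+1 =
    complete_sym xs n.+1 + x * complete_sym (x :: xs) n.
Proof.
rewrite /= big_ord_recl expr0 mul1r subn0 mulr_sumr; congr (_ + _).
by apply: eq_bigr => i _; rewrite lift0 subSS exprS mulrA.
Qed.

Lemma complete_sym_seq1 x n : complete_sym [:: x] n = x ^+ n.
Proof.
elim: n => [|n IHn]; first by rewrite complete_sym0.
by rewrite complete_sym_consS IHn add0r exprS.
Qed.

Lemma complete_sym_divdiff x y xs n :
  (x - y) * complete_sym (x :: y :: xs) n =
    complete_sym (x :: xs) n.+1 - complete_sym (y :: xs) n.+1.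
Proof.
elim: n => [|n IHn]; first by rewrite !complete_sym_consS !complete_sym0; ring.
rewrite (complete_sym_consS x (y :: xs)) mulrDr mulrCA IHn.
by rewrite !(complete_sym_consS _ xs n.+1); ring.
Qed.

Lemma complete_sym_consNSS x xs n :
  complete_sym (x :: - x :: xs) n.+2 =
    complete_sym xs n.+2 + x ^+ 2 * complete_sym (x :: - x :: xs) n.
Proof.
rewrite (complete_sym_consS x _ n.+1) (complete_sym_consS x _ n).
by rewrite (complete_sym_consS (- x) xs n.+1); ring.
Qed.

Lemma complete_sym_consN_odd x xs :
  (forall n, odd n -> complete_sym xs n = 0) ->
  forall n, odd n -> complete_sym (x :: - x :: xs) n = 0.
Proof.
move=> xs0 n; elim/ltn_ind: n => -[|[|n]] // IHn n_odd.
  by rewrite !complete_sym_consS !complete_sym0 xs0 //; ring.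
rewrite complete_sym_consNSS xs0 // IHn ?mulr0 ?addr0 //.
by move: n_odd; rewrite /= negbK.
Qed.

Lemma complete_sym_cons_widen x xs n N : (n < N)%N ->
  complete_sym (x :: xs) n =
    \sum_(i < N | (i <= n)%N) x ^+ i * complete_sym xs (n - i)%N.
Proof.
by move=> lt_nN; rewrite /= (big_ord_widen N (fun i => x ^+ i * _ (n - i)%N)).
Qed.

Lemma complete_sym_tetrahedron x y z n :
  complete_sym [:: x; y; z; 1] n =
    \sum_(i : 'I_n.+1 * 'I_n.+1 * 'I_n.+1 | (i.1.1 + i.1.2 + i.2 < n.+1)%N)
       x ^+ i.1.1 * y ^+ i.1.2 * z ^+ i.2.
Proof.
have widen u us j : complete_sym (u :: us) (n - j)%N =
    \sum_(i < n.+1 | (i <= n - j)%N) u ^+ i * complete_sym us (n - j - i)%N.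
  by apply: complete_sym_cons_widen; rewrite ltnS leq_subr.
rewrite (complete_sym_cons_widen _ _ (ltnSn n)).
under eq_bigr => i _.
  rewrite widen mulr_sumr.
  under eq_bigr => j _.
    rewrite -subnDA widen !mulr_sumr.
    under eq_bigr => k _ do rewrite complete_sym_seq1 expr1n mulr1 !mulrA.
    over.
  over.
rewrite !pair_big_dep /=.
by apply: eq_bigl => -[[i j] k] /=; lia.
Qed.

End CompleteSymmetricPolynomial.

(** Extended by zero to the degrees [-1, ..., - size xs], [complete_sym] is
    [N]-periodic in the degree; [n] is congruent to the degree [- j]. *)
Lemma complete_sym_unity_roots (R : idomainType) N (x : R) xs n j :
  all N.-unity_root (x :: xs) -> uniq (x :: xs) ->
  (j <= size xs)%N -> (N %| n + j)%N ->
  complete_sym (x :: xs) n = (j == 0%N)%:R.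
Proof.
elim: xs x n j => [|y xs IHxs] x n j.
  rewrite leqn0 => /andP[/unity_rootP xN _] _ /eqP->; rewrite addn0.
  by rewrite complete_sym_seq1; apply: expr_dvd.
move=> /and3P[xN yN xsN] /and3P[/norP[neq_xy x_xs] y_xs xs_uniq] le_j N_dvd.
have xxs_N : all N.-unity_root (x :: xs) by apply/andP.
have yxs_N : all N.-unity_root (y :: xs) by apply/andP.
have xxs_uniq : uniq (x :: xs) by apply/andP.
have yxs_uniq : uniq (y :: xs) by apply/andP.
have sym_eq0 k i : (i <= size xs)%N -> (N %| k + i.+1)%N ->
  complete_sym (x :: y :: xs) k = 0.
  move=> le_i; rewrite addnS -addSn => N_dvd_ki.
  apply: (mulfI (_ : x - y != 0)); first by rewrite subr_eq0.
  rewrite complete_sym_divdiff mulr0.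
  by rewrite (IHxs x _ i) // (IHxs y _ i) // subrr.
case: j le_j N_dvd => [|j] le_j N_dvd; last exact: sym_eq0 N_dvd.
case: n N_dvd => [|n] N_dvd; first by rewrite complete_sym0.
rewrite complete_sym_consS (IHxs y _ 0%N) // (sym_eq0 n 0%N) ?mulr0 ?addr0 //.
by rewrite addn1 -[n.+1]addn0.
Qed.

Section ZpExponents.

Variables (R : pzSemiRingType) (m : nat) (w : R).
Hypotheses (m_gt1 : (1 < m)%N) (wm : w ^+ m = 1).
Implicit Types u v d : 'Z_m.

Lemma expr_ZpD u v : w ^+ (u + v)%R = w ^+ u * w ^+ v.
Proof. by rewrite -exprD /= [X in (_ %% X)%N]Zp_cast // expr_mod. Qed.

Lemma expr_Zp_mulrn u n : w ^+ (u *+ n)%R = (w ^+ u) ^+ n.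
Proof. by elim: n => // n IHn; rewrite mulrS expr_ZpD IHn exprS. Qed.

Lemma expr_ZpB_eq1 u v : (w ^+ (u - v)%R == 1) = (w ^+ u == w ^+ v).
Proof.
apply/eqP/eqP => [w_uv | eq_uv].
  by rewrite -(subrK v u) expr_ZpD w_uv mul1r.
by rewrite expr_ZpD eq_uv -expr_ZpD subrr.
Qed.

Lemma expr_gcdZ_eq1 d : (w ^+ d == 1) = (w ^+ gcdZ d == 1).
Proof.
apply/eqP/eqP => [wd | w_gcd]; last exact: expr_dvd w_gcd (dvdn_gcdl _ _).
rewrite /gcdZ gcdnC.
have [k l def_km _] := egcdnP d (ltnW m_gt1).
have := expr_dvd wm (dvdn_mull k (dvdnn m)).
by rewrite def_km exprD mulnC exprM wd expr1n mul1r.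
Qed.

Lemma expr_Zp_unit_eq1 d : d \is a GRing.unit -> (w ^+ d == 1) = (w == 1).
Proof.
move=> d_unit; rewrite expr_gcdZ_eq1 /gcdZ.
have /eqP-> : coprime d m by rewrite coprime_sym -unitZpE // natr_Zp.
by rewrite expr1.
Qed.

End ZpExponents.

Lemma expr_Zp_unitN1 (R : idomainType) m (w : R) (d : 'Z_m) : (1 < m)%N ->
  w ^+ m = 1 -> w ^+ 2 = 1 -> w != 1 -> d \is a GRing.unit -> w ^+ d = -1.
Proof.
move=> m_gt1 wm w2 w_neq1 d_unit; apply/eqP.
have : (w ^+ d) ^+ 2 == 1 by rewrite exprAC w2 expr1n.
by rewrite sqrf_eq1 expr_Zp_unit_eq1 // (negPf w_neq1).
Qed.

Section FourierInversion.

Variables (R : idomainType) (m : nat).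

Lemma sum_expr_unity_root (w : R) :
  w ^+ m = 1 -> \sum_(k < m) w ^+ k = (m * (w == 1))%:R.
Proof.
move=> wm; have [-> | w_neq1] := eqVneq w 1.
  by under eq_bigr do rewrite expr1n; rewrite sumr_const card_ord muln1.
rewrite muln0; apply: (mulfI (_ : w - 1 != 0)); first by rewrite subr_eq0.
by rewrite -subrX1 wm subrr mulr0.
Qed.

Variable z : R.
Hypotheses (m_gt1 : (1 < m)%N) (z_prim : m.-primitive_root z).

Lemma fourier_count_mem (L : seq 'Z_m) (v : 'Z_m) :
  \sum_(k < m) z ^+ k ^+ (- v)%R * (\sum_(u <- L) z ^+ k ^+ u) =
    (m * count_mem v L)%:R.
Proof.
have zm := prim_expr_order z_prim.
have zkm k : (z ^+ k) ^+ m = 1 by rewrite exprAC zm expr1n.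
have lt_m (x : 'Z_m) : (x < m)%N by rewrite -[X in (_ < X)%N](Zp_cast m_gt1).
under eq_bigr do rewrite mulr_sumr.
rewrite exchange_big -sum1_count big_distrr natr_sum [RHS]big_mkcond.
apply: eq_bigr => u _.
under eq_bigr do rewrite mulrC -expr_ZpD // exprAC.
rewrite sum_expr_unity_root // expr_ZpB_eq1 //.
rewrite (eq_prim_root_expr z_prim) !modn_small //= -val_eqE.
by case: eqP => _; rewrite ?muln1 ?muln0.
Qed.

End FourierInversion.

Lemma balanced_seq_mset_fourier m (L : seq 'Z_m) : (1 < m)%N ->
  (forall w : algC, w ^+ m = 1 -> w != 1 -> \sum_(u <- L) w ^+ u = 0) ->
  balanced (seq_mset L).
Proof.
move=> m_gt1 L0; have m_gt0 := ltnW m_gt1.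
have [z z_prim] := C_prim_root_exists m_gt0.
suff count_mem_eq v : (m * count_mem v L)%N = size L.
  move=> u v; rewrite !mset_seqE; apply/eqP.
  by rewrite -(eqn_pmul2l m_gt0) !count_mem_eq.
apply/eqP; rewrite -(eqr_nat algC) -(fourier_count_mem m_gt1 z_prim).
rewrite (bigD1 (Ordinal m_gt0)) //= [X in _ + X]big1 => [|k k_neq0].
  rewrite expr0 expr1n mul1r addr0; under eq_bigr do rewrite expr1n.
  by rewrite -sum1_size natr_sum.
have zk_neq1 : z ^+ k != 1.
  by rewrite -(prim_order_dvd z_prim) gtnNdvd // lt0n.
by rewrite L0 ?mulr0 // exprAC (prim_expr_order z_prim) expr1n.
Qed.

Lemma balanced_AS_fourier m (a d1 d2 d3 : 'Z_m) n : (1 < m)%N ->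
  (forall w : algC, w ^+ m = 1 -> w != 1 ->
     complete_sym [:: w ^+ d1; w ^+ d2; w ^+ d3; 1] n = 0) ->
  balanced (AS a (d1, d2, d3) n.+1).
Proof.
move=> m_gt1 sym0; apply: balanced_seq_mset_fourier => // w wm w_neq1.
rewrite big_image -[RHS](mulr0 (w ^+ a)) -[X in _ * X](sym0 w) //.
rewrite complete_sym_tetrahedron mulr_sumr; apply: eq_big => // i _.
by rewrite !expr_ZpD // !expr_Zp_mulrn // !mulrA.
Qed.

Theorem theorem3p15 (m : nat) (m_gt0 : (0 < m)%N) (m_even : (2 %| m)%N)
    (m_n3 : ~~ (3 %| m)%N) (a d1 d2 d3 : 'Z_m)
    (gcd_d1 : gcdZ d1 = 2%N) (gcd_d32 : gcdZ (d3 - d2) = 2%N)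
    (unit_d2 : d2 \is a GRing.unit) (unit_d3 : d3 \is a GRing.unit)
    (unit_d21 : d2 - d1 \is a GRing.unit)
    (unit_d13 : d1 - d3 \is a GRing.unit)
    (s : nat) (s_gt0 : (0 < s)%N)
    (s_mod : (s%:Z = 0 %[mod m%:Z])%Z \/ (s%:Z = - 2 %[mod m%:Z])%Z) :
  balanced (AS a (d1, d2, d3) s).
Proof.
have m_gt1 : (1 < m)%N := dvdn_leq m_gt0 m_even.
have s_dvd : (m %| s)%N \/ (m %| s + 2)%N.
  by case: s_mod => /eqP; rewrite eqz_mod_dvd ?subr0 ?opprK; [left | right].
case: s s_gt0 s_dvd {s_mod} => // n _ n_dvd.
have n_odd : odd n by case: n_dvd => /(dvdn_trans m_even); lia.
apply: balanced_AS_fourier => // w wm w_neq1.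
have gcd2_eq1 (d : 'Z_m) : gcdZ d = 2%N -> (w ^+ d == 1) = (w ^+ 2 == 1).
  by move=> d_gcd2; rewrite expr_gcdZ_eq1 ?d_gcd2.
have [w2 | w2_neq1] := eqVneq (w ^+ 2) 1.
  have /eqP-> : w ^+ d1 == 1 by rewrite gcd2_eq1 ?w2.
  rewrite !(expr_Zp_unitN1 m_gt1 wm w2) // -[X in [:: _; _; _; X]]opprK.
  by apply: complete_sym_consN_odd n_odd; apply: complete_sym_consN_odd; case.
have roots_m : all m.-unity_root [:: w ^+ d1; w ^+ d2; w ^+ d3; 1].
  by rewrite /= !unity_rootE !(exprAC _ _ m) wm !expr1n eqxx.
have roots_uniq : uniq [:: w ^+ d1; w ^+ d2; w ^+ d3; 1].
  rewrite /= !inE !negb_or andbT (eq_sym (w ^+ d1) (w ^+ d2)).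
  rewrite (eq_sym (w ^+ d2) (w ^+ d3)) -!expr_ZpB_eq1 //.
  rewrite (gcd2_eq1 d1) // (gcd2_eq1 (d3 - d2)) // w2_neq1.
  by rewrite !expr_Zp_unit_eq1 // w_neq1.
case: n_dvd => n_dvd.
  by apply: (complete_sym_unity_roots (j := 1) roots_m); rewrite ?addn1.
by apply: (complete_sym_unity_roots (j := 3) roots_m); rewrite // addnS -addSn.
Qed.
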